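(* For every $\rho^\star>0$ there is a constant $C>0$ depending only on $\rho^\star$ such that the following holds for every positive integer $N$, with $\epsilon=1/N$, and all $\boldsymbol{f}:\mathscr{I}_N\to\mathbb{R}^2$ and $\tau:\mathscr{I}_N\to\mathbb{R}$. Suppose that $$\begin{bmatrix}\hat{\boldsymbol{f}}[0,0]\\ \hat{\tau}[0,0]\end{bmatrix}\in \operatorname{im}\big(S_{D}[0,0]\big).$$ Then there exist solutions $(\hat{\boldsymbol{u}}_D[i',j'],\hat\theta_D[i',j'])$ of $$S_D[i',j']\begin{bmatrix}\hat{\boldsymbol{u}}_D[i',j']\\ \hat\theta_D[i',j']\end{bmatrix}=\begin{bmatrix}\hat{\boldsymbol{f}}[i',j']\\ \hat\tau[i',j']\end{bmatrix}$$ and solutions $(\hat{\boldsymbol{u}}_C[i',j'],\hat\theta_C[i',j'])$ of $$S_C[i',j']\begin{bmatrix}\hat{\boldsymbol{u}}_C[i',j']\\ \hat\theta_C[i',j']\end{bmatrix}=\begin{bmatrix}\hat{\boldsymbol{f}}[i',j']\\ \hat\tau[i',j']\end{bmatrix}$$ for all $(i',j')\in\mathscr{F}_N$, and these solutions are unique for $(i',j')\in\mathscr{F}_N^\circ$. If additionally $\hat{\boldsymbol{u}}_D[0,0]=\hat{\boldsymbol{u}}_C[0,0]$ and $\hat\theta_D[0,0]=\hat\theta_C[0,0]$, then $$\|\boldsymbol{u}_D-\boldsymbol{u}_C\|_0\le C\epsilon^2\big(\|\boldsymbol{f}\|_0+|\tau|_1\big),\qquad \|\theta_D-\theta_C\|_0\le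 C\epsilon^2\big(|\boldsymbol{f}|_1+|\tau|_2\big).$$
   Context: Let $N$ be a positive integer and $\epsilon=1/N$. Index sets: $\mathscr{I}_N=\{(i,j)\in\mathbb{Z}^2: 0\le i,j<N\}$, $\mathscr{F}_N=\{(i',j')\in\mathbb{Z}^2:-N/2\le i',j'<N/2\}$, $\mathscr{F}_N^\circ=\mathscr{F}_N\setminus\{(0,0)\}$. The imaginary unit is $\mathrm{i}$. The discrete Fourier transform of a scalar or vector valued $f$ on $\mathscr{I}_N$ is, for $(i',j')\in\mathscr{F}_N$ (entrywise), $\hat f[i',j']=\frac{1}{N^2}\sum_{(i,j)\in\mathscr{I}_N}f[i,j]\exp(-2\pi \mathrm{i}(ii'+jj')/N)$. Vectors: $\boldsymbol{l}_1=[1/2,-\sqrt3/2]^\top$, $\boldsymbol{l}_2=[1,0]^\top$, $\boldsymbol{l}_3=[1/2,\sqrt3/2]^\top$; $\boldsymbol{l}^\perp$ is $\boldsymbol{l}$ rotated counterclockwise by $\pi/2$; $\boldsymbol{a}\otimes\boldsymbol{b}=\boldsymbol{a}\boldsymbol{b}^\top$ (no conjugation). $\rho^\star>0$ is a fixed parameter independent of $\epsilon$. Write $k_1=i'$, $k_2=i'+j'$, $k_3=j'$. Discrete (lattice) model: for $(i',j')\in\mathscr{F}_N$, $$A_D[i',j']=\sum_{t=1}^3 4(\rho^\star\boldsymbol{l}_t\otimes\boldsymbol{l}_t+12\,\boldsymbol{l}_t^\perp\otimes\boldsymbol{l}_t^\perp)\frac{\sin^2(\pi k_t\epsilon)}{\epsilon^2},\quad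 \boldsymbol{b}_D[i',j']=\sum_{t=1}^3 12\,\mathrm{i}\,\boldsymbol{l}_t^\perp\frac{\sin(2\pi k_t\epsilon)}{\epsilon},\quad c_D[i',j']=\sum_{t=1}^3\big(12-8\sin^2(\pi k_t\epsilon)\big),$$ $$S_D[i',j']=\begin{bmatrix}A_D&\boldsymbol{b}_D\\-\boldsymbol{b}_D^\top&c_D\end{bmatrix}[i',j']\in\mathbb{C}^{3\times3}.$$ Continuum (homogenized) model: $$A_C[i',j']=\sum_{t=1}^3 4(\rho^\star\boldsymbol{l}_t\otimes\boldsymbol{l}_t+12\,\boldsymbol{l}_t^\perp\otimes\boldsymbol{l}_t^\perp)\pi^2k_t^2,\quad \boldsymbol{b}_C[i',j']=\sum_{t=1}^3 24\,\mathrm{i}\,\boldsymbol{l}_t^\perp\pi k_t,\quad c_C[i',j']=36,$$ $$S_C[i',j']=\begin{bmatrix}A_C&\boldsymbol{b}_C\\-\boldsymbol{b}_C^\top&c_C\end{bmatrix}[i',j'].$$ $\boldsymbol{u}_D,\theta_D$ are the functions on $\mathscr{I}_N$ whose discrete Fourier transforms are $\hat{\boldsymbol{u}}_D,\hat\theta_D$; $\boldsymbol{u}_C,\theta_C$ are the trigonometric polynomials on $(0,1)^2$ with Fourier coefficients $\hat{\boldsymbol{u}}_C[i',j'],\hat\theta_C[i',j']$, $(i',j')\in\mathscr{F}_N$. Norms are defined by Fourier coefficients: for discrete $f$, $\|f\|_0^2=\sum_{(i',j')\in\mathscr{F}_N}|\hat f[i',j']|^2$ and, for $s>0$, $|f|_s^2=\sum_{(i',j')\in\mathscr{F}_N}(|i'|^{2s}+|j'|^{2s})|\hat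 f[i',j']|^2$, where $|\cdot|$ is the Euclidean norm for vectors. The norms of the differences $\boldsymbol{u}_D-\boldsymbol{u}_C$ and $\theta_D-\theta_C$ are defined by the same formulas with $\hat f$ replaced by $\hat{\boldsymbol{u}}_D-\hat{\boldsymbol{u}}_C$, respectively $\hat\theta_D-\hat\theta_C$. *)

(* Defs.v *)
From HB Require Import structures.
From mathcomp Require Import all_boot all_order all_algebra.
From mathcomp Require Import complex zify.
From mathcomp Require Import boolp classical_sets functions cardinality fsbigop.
From mathcomp Require Import reals trigo.

Set Implicit Arguments.
Unset Strict Implicit.
Unset Printing Implicit Defensive.

Import Order.TTheory GRing.Theory Num.Theory.
Import ComplexField.Normc.
Local Open Scope classical_set_scope.
Local Open Scope complex_scope.
Local Open Scope ring_scope.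

(* The index set I_N is 'I_N * 'I_N; F_N is the set of integer frequencies
   (i', j') with -N/2 <= i', j' < N/2 (real division, hence the doubling). *)
Definition freqs (N : nat) : set (int * int) :=
  [set k | (- N%:Z <= 2 * k.1 < N%:Z) /\ (- N%:Z <= 2 * k.2 < N%:Z)].

Definition freqs0 (N : nat) : set (int * int) := freqs N `\ (0, 0).

(* Sums \sum_(k \in freqs N) are 0 by convention on infinite supports; this
   lemma shows that the convention never applies. *)
Lemma finite_freqs (N : nat) : finite_set (freqs N).
Proof.
pose g (p : 'I_(N + N).+1 * 'I_(N + N).+1) : int * int :=
  ((p.1 : nat)%:Z - N%:Z, (p.2 : nat)%:Z - N%:Z).
have bnd (m : int) : - N%:Z <= 2 * m < N%:Z ->
    exists i : 'I_(N + N).+1, m = (i : nat)%:Z - N%:Z.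
  move=> mN; have ltm : (absz (m + N%:Z)%R < (N + N).+1)%N by lia.
  by exists (Ordinal ltm) => /=; lia.
apply: (@sub_finite_set _ _ (range g)).
  by move=> [a b] [/= /bnd[i ->] /bnd[j ->]]; exists (i, j).
exact/finite_image/finite_finset.
Qed.

Section Fourier.
Variable R : realType.
Implicit Types (N s : nat) (k : int * int).

Definition expi (x : R) : R[i] := cos x +i* sin x.

Definition dft N (f : 'I_N * 'I_N -> R[i]) k : R[i] :=
  (N%:R ^+ 2)^-1 * \sum_(p : 'I_N * 'I_N)
    f p * expi (- 2 * pi * ((p.1%:Z * k.1 + p.2%:Z * k.2)%:~R / N%:R)).

Definition dft_real N (f : 'I_N * 'I_N -> R) : int * int -> R[i] :=
  dft (fun p => (f p)%:C).

Definition dft_vec N n (f : 'I_N * 'I_N -> 'cV[R]_n) k : 'cV[R[i]]_n :=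
  \col_m dft_real (fun p => f p m 0) k.

(* The library norm on 'cV is the sup norm. *)
Definition enorm n (v : 'cV[R[i]]_n) : R := Num.sqrt (\sum_m normc (v m 0) ^+ 2).

(* Both norms take the moduli |f^[k]| of the Fourier coefficients, so that
   they apply to scalars (through normc) and vectors (through enorm). *)
Definition norm0 N (a : int * int -> R) : R :=
  Num.sqrt (\sum_(k \in freqs N) a k ^+ 2).

(* Only meant for s > 0: at s = 0 both weights are 1. *)
Definition seminorm N s (a : int * int -> R) : R :=
  Num.sqrt (\sum_(k \in freqs N)
    ((`|k.1| ^+ (2 * s) + `|k.2| ^+ (2 * s))%:~R * a k ^+ 2)).

End Fourier.

Section Models.
Variable R : realType.
Implicit Types (rho : R) (N : nat) (k : int * int) (t : 'I_3).

Definition vec2 (x y : R) : 'cV[R]_2 := \col_m (if m == 0 then x else y).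

Definition perp (v : 'cV[R]_2) : 'cV[R]_2 := vec2 (- v 1 0) (v 0 0).

Definition lvec t : 'cV[R]_2 :=
  [:: vec2 (1 / 2) (- (Num.sqrt 3 / 2)); vec2 1 0;
      vec2 (1 / 2) (Num.sqrt 3 / 2)]`_t.

Definition wnum k t : int := [:: k.1; k.1 + k.2; k.2]`_t.

Definition outer (a b : 'cV[R]_2) : 'M[R]_2 := a *m b^T.

Definition bond_mx rho t : 'M[R]_2 :=
  rho *: outer (lvec t) (lvec t) + 12 *: outer (perp (lvec t)) (perp (lvec t)).

Definition toC {m n} (A : 'M[R]_(m, n)) : 'M[R[i]]_(m, n) :=
  map_mx (real_complex R) A.

(* The off-diagonal blocks are b and - b^T: transposed without conjugation. *)
Definition sys_mx (A : 'M[R]_2) (b : 'cV[R[i]]_2) (c : R) : 'M[R[i]]_(2 + 1) :=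
  block_mx (toC A) b (- b^T) (c%:C)%:M.

Definition eps N : R := N%:R^-1.

Definition AD rho N k : 'M[R]_2 :=
  \sum_(t < 3) (4 * (sin (pi * (wnum k t)%:~R * eps N) ^+ 2 / eps N ^+ 2))
    *: bond_mx rho t.

Definition bD N k : 'cV[R[i]]_2 :=
  \sum_(t < 3) (12 * 'i%C * (sin (2 * pi * (wnum k t)%:~R * eps N) / eps N)%:C)
    *: toC (perp (lvec t)).

Definition cD N k : R :=
  \sum_(t < 3) (12 - 8 * sin (pi * (wnum k t)%:~R * eps N) ^+ 2).

Definition SD rho N k := sys_mx (AD rho N k) (bD N k) (cD N k).

Definition AC rho k : 'M[R]_2 :=
  \sum_(t < 3) (4 * (pi ^+ 2 * (wnum k t)%:~R ^+ 2)) *: bond_mx rho t.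

Definition bC k : 'cV[R[i]]_2 :=
  \sum_(t < 3) (24 * 'i%C * (pi * (wnum k t)%:~R)%:C) *: toC (perp (lvec t)).

Definition SC rho k := sys_mx (AC rho k) (bC k) 36.

Definition stack (u : 'cV[R[i]]_2) (th : R[i]) : 'cV[R[i]]_(2 + 1) :=
  col_mx u th%:M.

Definition load N (f : 'I_N * 'I_N -> 'cV[R]_2) (tau : 'I_N * 'I_N -> R) k :=
  stack (dft_vec f k) (dft_real tau k).

(* u and th are families of Fourier coefficients; values off F_N are
   irrelevant. *)
Definition solves N (S : int * int -> 'M[R[i]]_(2 + 1))
    (g : int * int -> 'cV[R[i]]_(2 + 1))
    (u : int * int -> 'cV[R[i]]_2) (th : int * int -> R[i]) : Prop :=
  forall k, freqs N k -> S k *m stack (u k) (th k) = g k.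

End Models.

(* Main.v *)
Require Import Defs.
From HB Require Import structures.
From mathcomp Require Import all_boot all_order all_algebra.
From mathcomp Require Import complex ring lra.
From mathcomp Require Import boolp classical_sets functions cardinality fsbigop.
From mathcomp Require Import reals trigo topology normedtype derive.

Set Implicit Arguments.
Unset Strict Implicit.
Unset Printing Implicit Defensive.

Import Order.TTheory GRing.Theory Num.Theory.
Import ComplexField.Normc numFieldNormedType.Exports.
Local Open Scope classical_set_scope.
Local Open Scope complex_scope.
Local Open Scope ring_scope.

(** The estimate is a perturbation argument carried out separately at each
    frequency k, with eps = 1/N and K^2 = (pi k.1)^2 + (pi k.2)^2.

    Both symbols come from one family. Write L_t = l_t . u and
    P_t = l_t^perp . u, and let sg_t be the wave number seen by the model:
    sin(pi k_t eps)/eps on the lattice, pi k_t in the continuum. With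
    g_t^2 + s_t^2 = 1, where (g_t, s_t) is (cos, sin)(pi k_t eps) on the lattice
    and (1, 0) in the continuum, the Hermitian form of the symbol at (u, theta)
    is a sum of squares over the three bonds,
      4 rho (sg_t L_t)^2 + 48 |sg_t P_t + i g_t theta/2|^2 + 4 |s_t theta|^2.
    The substitution theta = i h makes the symbol real symmetric, so real and
    imaginary parts decouple and all inequalities are about real quadratic forms
    ([sform], [sform_twist]).

    Coercivity ([sform_coercive]): any two of l_1, l_2, l_3 span the plane, so
    the longitudinal terms control K^2 |u|^2 as soon as two of the sg_t are of
    size K. This is so for |pi k.i eps| <= pi/2: if sin(pi k_1 eps) and
    sin(pi k_3 eps) are of very different size then the addition formula makes
    sin(pi k_2 eps) comparable to the larger one ([along_weighted_lb]). The
    other two squares then control theta, so that K^2 |u|^2 + |theta|^2 is at most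
    a constant times the form, for both models. In particular both symbols are
    invertible off k = 0, while at k = 0 the two symbols coincide.

    Consistency: x - sin(x eps)/eps = O(eps^2 x^3), so the difference of the two
    forms is bounded by a constant times eps^2 K^2 in the same scaled norm
    ([sform_bounded], [stiffness_error], [coupling_error], [inertia_error]).

    Subtracting the two systems and testing with the error z_D - z_C gives
    |z_D - z_C| <= const eps^2 K^2 |z_C| in the scaled norm, and testing the
    continuum system with z_C gives K |z_C| <= const (|f| + K |tau|)
    ([perturbation_bound]). Hence |u_D - u_C| <= const eps^2 (|f| + K |tau|) and
    |theta_D - theta_C| <= const eps^2 (K |f| + K^2 |tau|) at every frequency
    ([mode_error]); squaring and summing over the frequencies gives the
    theorem. *)

(** * Elementary bounds on the sine *)

Section Sine.
Variable R : realType.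
Implicit Types x : R.

Lemma sin_mean_value x : 0 <= x ->
  exists2 y, 0 <= y <= x & sin x = cos y * x.
Proof.
move=> x0; have [|y] := MVT_segment x0 (fun y _ => is_derive_sin y).
  by apply: continuous_subspaceT; exact: continuous_sin.
by rewrite in_itv/= sin0 !subr0 => y0x ->; exists y.
Qed.

Lemma sin_le_id x : 0 <= x -> sin x <= x.
Proof.
move=> x0; have [y /andP[y0 yx] ->] := sin_mean_value x0.
by rewrite ler_piMl// cos_le1.
Qed.

Lemma norm_sin_le x : `|sin x| <= `|x|.
Proof.
wlog x0 : x / 0 <= x => [hw|].
  case: (lerP 0 x) => [/hw//|/ltW xle0].
  by rewrite -normrN -sinN -(normrN x) hw// oppr_ge0.
rewrite (ger0_norm x0) ler_norml sin_le_id// andbT.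
have [x1|x1] := lerP x 1.
  rewrite (le_trans (y := 0)) ?oppr_le0// sin_ge0_pi// x0 (le_trans x1)//.
  by rewrite (le_trans _ (pi_ge2 R))// ler1n.
by rewrite (le_trans _ (sin_geN1 x))// lerN2 ltW.
Qed.

Lemma sqr_sin_le x : sin x ^+ 2 <= x ^+ 2.
Proof.
rewrite -[leLHS]real_normK ?num_real// -[leRHS]real_normK ?num_real//.
by rewrite lerXn2r ?nnegrE// norm_sin_le.
Qed.

(** From [cos x = 1 - 2 sin^2(x/2)]. *)
Lemma cos_quadratic_lb x : 1 - x ^+ 2 / 2 <= cos x.
Proof.
have -> : x = (x / 2) *+ 2 by rewrite -mulr_natr divfK// pnatr_eq0.
rewrite cos_mulr2n cos2sin2; have := sqr_sin_le (x / 2).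
move: (sin _) => s; nra.
Qed.

(** The mean value theorem turns the quadratic bound on [1 - cos] into a cubic
    one. *)
Lemma id_sub_sin_cubic x : `|x - sin x| <= `|x| ^+ 3 / 2.
Proof.
wlog x0 : x / 0 <= x => [hw|].
  case: (lerP 0 x) => [/hw//|/ltW xle0].
  have := hw (- x); rewrite sinN -opprD !normrN; apply.
  by rewrite oppr_ge0.
rewrite (ger0_norm x0) ger0_norm; last by rewrite subr_ge0 sin_le_id.
have [y /andP[y0 yx] ->] := sin_mean_value x0.
have := cos_quadratic_lb y; move: (cos y) => c hc.
suff : 1 - x ^+ 2 / 2 <= c by move=> /(ler_wpM2r x0); lra.
apply: le_trans hc; rewrite lerD2l lerN2 ler_pM2r ?invr_gt0//.
by rewrite lerXn2r ?nnegrE// ?x0.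
Qed.

Lemma sin_half_lb x : 0 <= x -> x <= 1 -> x / 2 <= sin x.
Proof.
move=> x0 x1; have := id_sub_sin_cubic x.
rewrite (ger0_norm x0) => /ler_normlP[_].
have : x ^+ 3 <= x by rewrite exprS ler_piMr// expr_le1.
lra.
Qed.

(** Jordan's inequality with a non-optimal constant. Halving the argument
    brings it into [0, 1], where the Taylor bounds are effective, whereas the
    range of interest |x| <= pi/2 is contained in |x| <= 2. *)
Lemma sqr_sin_lb x : `|x| <= 2 -> x ^+ 2 / 16 <= sin x ^+ 2.
Proof.
wlog x0 : x / 0 <= x => [hw x2|].
  case: (lerP 0 x) => [/hw|/ltW xle0]; first exact.
  by rewrite -sqrrN -[leRHS]sqrrN -sinN hw ?oppr_ge0// normrN.
rewrite (ger0_norm x0) => x2.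
have -> : x = (x / 2) *+ 2 by rewrite -mulr_natr divfK// pnatr_eq0.
set y := x / 2; rewrite sin_mulr2n.
have y0 : 0 <= y by rewrite /y; lra.
have y1 : y <= 1 by rewrite /y; lra.
have := cos_quadratic_lb y; have := sin_half_lb y0 y1.
move: (sin y) (cos y) => s c hs hc.
have y21 : y ^+ 2 <= 1 by rewrite expr_le1.
have {}hc : 1 / 2 <= c by lra.
have : (y * 2^-1) * (1 / 2) <= s * c by apply: ler_pM; lra.
have : 0 <= y * 2^-1 by lra.
rewrite (mulrC c s); move: (s * c) => sc y4 scy.
have y80 : 0 <= y * 2^-1 * (1 / 2) by lra.
have := ler_pM y80 y80 scy scy.
lra.
Qed.

End Sine.

(** * The real quadratic form of a symbol *)

Section RealForm.
Variable R : realType.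
Implicit Types (rho c K : R) (p q sg : 'I_3 -> R) (u : 'cV[R]_2).
Implicit Types (v w : 'cV[R]_2 * R) (t : 'I_3).

Definition dot (u u' : 'cV[R]_2) : R := u 0 0 * u' 0 0 + u 1 0 * u' 1 0.

(** The components of a displacement along a bond and across it. *)
Definition along t u : R := dot (lvec R t) u.

Definition across t u : R := dot (perp (lvec R t)) u.

Definition sdot w v : R := dot w.1 v.1 + w.2 * v.2.

(** The bilinear form of a symbol after the substitution theta = i h, on pairs
    (u, h). The stiffnesses [p], couplings [q] and inertia [c] are kept
    independent so that the difference of two symbols is again of this form. *)
Definition sform rho p q c w v : R :=
  \sum_t (4 * p t * (rho * (along t w.1 * along t v.1) +
                     12 * (across t w.1 * across t v.1))
          - 24 * q t * (across t w.1 * v.2 + across t v.1 * w.2))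
  + c * (w.2 * v.2).

(** Here 2304 = (1 + 8) * 1024 / 4: the longitudinal energy 4 rho sum (sg L)^2
    controls K^2 |u|^2 at the price 1024 / (4 rho), and h^2 is controlled by 8
    K^2 |u|^2 and the other two squares. *)
Definition coercivity_const rho : R := 2304 / rho + 1.

(** The square of the norm in which both symbols are uniformly well
    conditioned: their diagonal blocks are of order K^2 and 1. *)
Definition snorm2 K v : R := K ^+ 2 * dot v.1 v.1 + v.2 ^+ 2.

Lemma sum_I3 (V : zmodType) (F : 'I_3 -> V) : \sum_t F t = F 0 + F 1 + F 2.
Proof.
rewrite !big_ord_recl big_ord0 addr0 addrA.
by congr (_ + F _ + F _); apply: val_inj.
Qed.

Lemma forall_I3 (P : 'I_3 -> Prop) : P 0 -> P 1 -> P 2 -> forall t, P t.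
Proof.
move=> P0 P1 P2 [[|[|[|//]]] lt_t].
- by have -> : Ordinal lt_t = 0 by apply: val_inj.
- by have -> : Ordinal lt_t = 1 by apply: val_inj.
- by have -> : Ordinal lt_t = 2 by apply: val_inj.
Qed.

Lemma dot_ge0 u : 0 <= dot u u.
Proof. by rewrite addr_ge0 // -expr2 sqr_ge0. Qed.

Lemma snorm2_ge0 K v : 0 <= snorm2 K v.
Proof.
apply: addr_ge0; last exact: sqr_ge0.
by apply: mulr_ge0; [exact: sqr_ge0 | exact: dot_ge0].
Qed.

Lemma alongE u : [/\ along 0 u = u 0 0 / 2 - Num.sqrt 3 / 2 * u 1 0,
  along 1 u = u 0 0 & along 2 u = u 0 0 / 2 + Num.sqrt 3 / 2 * u 1 0].
Proof. by split; rewrite /along /dot /lvec /= !mxE /=; ring. Qed.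

Lemma acrossE u : [/\ across 0 u = Num.sqrt 3 / 2 * u 0 0 + u 1 0 / 2,
  across 1 u = u 1 0 & across 2 u = - (Num.sqrt 3 / 2) * u 0 0 + u 1 0 / 2].
Proof. by split; rewrite /across /dot /perp /lvec /= !mxE /=; ring. Qed.

Lemma sqr_sqrt3 : Num.sqrt 3 ^+ 2 = 3 :> R.
Proof. by rewrite sqr_sqrtr. Qed.

Lemma along2_across2 t u : along t u ^+ 2 + across t u ^+ 2 = dot u u.
Proof.
have r3 := sqr_sqrt3; have [l0 l1 l2] := alongE u; have [c0 c1 c2] := acrossE u.
by elim/forall_I3: t; rewrite ?(l0, l1, l2, c0, c1, c2) /dot; field: r3.
Qed.

Lemma across2_le t u : across t u ^+ 2 <= dot u u.
Proof. by rewrite -(along2_across2 t) lerDr sqr_ge0. Qed.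

Lemma along2_le t u : along t u ^+ 2 <= dot u u.
Proof. by rewrite -(along2_across2 t) lerDl sqr_ge0. Qed.

Lemma sum_along2 u :
  along 0 u ^+ 2 + along 1 u ^+ 2 + along 2 u ^+ 2 = 3 / 2 * dot u u.
Proof.
have r3 := sqr_sqrt3; have [-> -> ->] := alongE u; rewrite /dot.
by field: r3.
Qed.

Lemma along1E u : along 1 u = along 0 u + along 2 u.
Proof. by have [-> -> ->] := alongE u; field. Qed.

(** Completing the square in h: the inertia 12 - 8 s^2 exceeds the 12 g^2 used
    up by the coupling term by exactly 4 s^2. This is why the lattice form,
    whose coupling degenerates where g = 0, is as coercive as the continuum
    one. *)
Lemma sform_sum_squares rho sg ga s v :
  (forall t, ga t ^+ 2 + s t ^+ 2 = 1) ->
  sform rho (fun t => sg t ^+ 2) (fun t => sg t * ga t)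
    (\sum_t (12 - 8 * s t ^+ 2)) v v =
  \sum_t (4 * rho * (sg t * along t v.1) ^+ 2
          + 48 * (sg t * across t v.1 - ga t * v.2 / 2) ^+ 2
          + 4 * (s t * v.2) ^+ 2).
Proof.
move=> gas; rewrite /sform mulr_suml -big_split /=; apply: eq_bigr => t _.
rewrite !exprMn; have -> : s t ^+ 2 = 1 - ga t ^+ 2 by rewrite -(gas t); ring.
by field.
Qed.

(** In this lemma l0, l1, l2 stand for the longitudinal components, any two of
    which determine u, and s1 = s0 g2 + g0 s2 is the addition formula. When
    |s0| is the larger of |s0| and |s2|, either |s2| or |s1| is at least
    |s0|/4: if |s2| < |s0|/4 then g2 is close to 1 and s1 is close to s0. *)
Lemma along_weighted_lb_aux (x s0 s1 s2 g0 g2 l0 l1 l2 : R) :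
  l0 ^+ 2 + l1 ^+ 2 + l2 ^+ 2 = 3 / 2 * x -> l1 = l0 + l2 ->
  g0 ^+ 2 <= 1 -> s1 = s0 * g2 + g0 * s2 ->
  15 / 16 <= g2 ^+ 2 \/ s0 ^+ 2 <= 16 * s2 ^+ 2 -> s2 ^+ 2 <= s0 ^+ 2 ->
  (s0 ^+ 2 + s2 ^+ 2) * x <=
    64 * ((s0 * l0) ^+ 2 + (s1 * l1) ^+ 2 + (s2 * l2) ^+ 2).
Proof.
move=> lx l1E g01 s1E s02 s20.
have x01 : x <= 2 * (l0 ^+ 2 + l1 ^+ 2).
  by have := sqr_ge0 (l0 + l1); rewrite l1E in lx *; lra.
have x02 : x <= 2 * (l0 ^+ 2 + l2 ^+ 2).
  by have := sqr_ge0 (l0 - l2); rewrite l1E in lx *; lra.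
have x0 : 0 <= x.
  by have := sqr_ge0 l0; have := sqr_ge0 l1; have := sqr_ge0 l2; lra.
have s00 := sqr_ge0 s0.
have concl r l : 0 <= l ^+ 2 -> x <= 2 * (l0 ^+ 2 + l ^+ 2) ->
    s0 ^+ 2 <= 16 * r ^+ 2 ->
    (s0 ^+ 2 + s2 ^+ 2) * x <= 64 * ((s0 * l0) ^+ 2 + (r * l) ^+ 2).
  move=> ll xl rr; have := ler_wpM2r x0 s20; have := ler_wpM2l s00 xl.
  have := ler_wpM2r ll rr; rewrite !exprMn.
  have : 0 <= s0 ^+ 2 * l0 ^+ 2 by rewrite mulr_ge0 ?sqr_ge0.
  lra.
have sl1 := sqr_ge0 (s1 * l1); have sl2 := sqr_ge0 (s2 * l2).
have [s0s2|s2s0] := lerP (s0 ^+ 2) (16 * s2 ^+ 2).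
  by have := concl _ _ (sqr_ge0 l2) x02 s0s2; lra.
suff : s0 ^+ 2 <= 16 * s1 ^+ 2 by move=> /(concl _ _ (sqr_ge0 l1) x01); lra.
case: s02 => [g2_lb|]; last lra.
have := ler_wpM2l s00 g2_lb; have := ler_wpM2r (sqr_ge0 s2) g01.
have := sqr_ge0 (s0 * g2 + 2 * (g0 * s2)); rewrite s1E.
lra.
Qed.

(** Both models satisfy the disjunctions: on the lattice a cosine is close to
    1 unless the corresponding sine is bounded below, and in the continuum g0
    = g2 = 1. *)
Lemma along_weighted_lb u sg g0 g2 :
  g0 ^+ 2 <= 1 -> g2 ^+ 2 <= 1 -> sg 1 = sg 0 * g2 + g0 * sg 2 ->
  15 / 16 <= g2 ^+ 2 \/ sg 0 ^+ 2 <= 16 * sg 2 ^+ 2 ->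
  15 / 16 <= g0 ^+ 2 \/ sg 2 ^+ 2 <= 16 * sg 0 ^+ 2 ->
  (sg 0 ^+ 2 + sg 2 ^+ 2) * dot u u <= 64 * \sum_t (sg t * along t u) ^+ 2.
Proof.
move=> g01 g21 sg1 h02 h20; rewrite sum_I3.
have [s20|/ltW s02] := lerP (sg 2 ^+ 2) (sg 0 ^+ 2).
  exact: (along_weighted_lb_aux (sum_along2 u) (along1E u) g01 sg1).
have lx : along 2 u ^+ 2 + along 1 u ^+ 2 + along 0 u ^+ 2 = 3 / 2 * dot u u.
  by rewrite -sum_along2; ring.
have l1E : along 1 u = along 2 u + along 0 u by rewrite along1E addrC.
have s1E : sg 1 = sg 2 * g0 + g2 * sg 0 by rewrite sg1; ring.
have := along_weighted_lb_aux lx l1E g21 s1E h20 s02; lra.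
Qed.

(** K^2 |u|^2 is controlled by the first squares by assumption. For h, write
    h^2 = (g h)^2 + (s h)^2 on a single bond: s h enters the third square, and
    g h / 2 differs from sg P, which is at most K |u|, by the entry of the
    second square. *)
Lemma sform_coercive rho K sg ga s v : 0 < rho ->
  (forall t, ga t ^+ 2 + s t ^+ 2 = 1) -> sg 0 ^+ 2 <= K ^+ 2 ->
  K ^+ 2 * dot v.1 v.1 <= 1024 * \sum_t (sg t * along t v.1) ^+ 2 ->
  snorm2 K v <= coercivity_const rho *
    sform rho (fun t => sg t ^+ 2) (fun t => sg t * ga t)
      (\sum_t (12 - 8 * s t ^+ 2)) v v.
Proof.
move=> rho0 gas sg0K lb; rewrite sform_sum_squares// !big_split /= -!mulr_sumr.
set A := \sum_t _ in lb *; set B := \sum_t _; set D := \sum_t _.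
have Bt : (sg 0 * across 0 v.1 - ga 0 * v.2 / 2) ^+ 2 <= B.
  by rewrite /B (bigD1 ord0)//= lerDl sumr_ge0// => t _; rewrite sqr_ge0.
have Dt : (s 0 * v.2) ^+ 2 <= D.
  by rewrite /D (bigD1 ord0)//= lerDl sumr_ge0// => t _; rewrite sqr_ge0.
have A0 : 0 <= A by rewrite sumr_ge0// => t _; rewrite sqr_ge0.
have B0 : 0 <= B by rewrite sumr_ge0// => t _; rewrite sqr_ge0.
have D0 : 0 <= D by rewrite sumr_ge0// => t _; rewrite sqr_ge0.
have Pt : (sg 0 * across 0 v.1) ^+ 2 <= K ^+ 2 * dot v.1 v.1.
  by rewrite exprMn ler_pM ?sqr_ge0 ?across2_le.
have v2E : v.2 ^+ 2 = (ga 0 * v.2) ^+ 2 + (s 0 * v.2) ^+ 2.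
  by rewrite !exprMn -mulrDl gas mul1r.
have v2_le : v.2 ^+ 2 <= 8 * (K ^+ 2 * dot v.1 v.1) + 8 * B + D.
  have := sqr_ge0 (2 * (sg 0 * across 0 v.1) - ga 0 * v.2 / 2).
  rewrite v2E; set P := sg 0 * _ in Bt Pt *; set h := ga 0 * v.2 in Bt *.
  lra.
have rhoV : 2304 / rho * (4 * rho * A) = 9216 * A.
  by field; rewrite gt_eqF.
have r0 : 0 <= 2304 / rho by rewrite divr_ge0// ltW.
have := mulr_ge0 r0 B0; have := mulr_ge0 r0 D0; have := mulr_ge0 (ltW rho0) A0.
rewrite /snorm2 /coercivity_const; move: (2304 / rho) rhoV r0 => r rhoV r0.
lra.
Qed.

(** The constant counts, for each of the three bonds, 4 (rho + 12) for the
    stiffness and 48 for the coupling, and 3 for the inertia. *)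
Lemma sform_bounded rho mu K p q c w v : 0 <= rho -> 0 <= mu -> 0 <= K ->
  (forall t, `|p t| <= mu * K ^+ 2) -> (forall t, `|q t| <= mu * K) ->
  `|c| <= 3 * mu ->
  sform rho p q c w v ^+ 2 <=
    (mu * (12 * rho + 291)) ^+ 2 * (snorm2 K w * snorm2 K v).
Proof.
move=> rho0 mu0 K0 hp hq hc.
have K2 : `|K| = K by rewrite ger0_norm.
have vle z : `|z.2| <= Num.sqrt (snorm2 K z).
  by rewrite -sqrtr_sqr ler_wsqrtr// lerDr mulr_ge0 ?sqr_ge0 ?dot_ge0.
have lle (l : R) z : l ^+ 2 <= dot z.1 z.1 -> K * `|l| <= Num.sqrt (snorm2 K z).
  move=> lz; rewrite -{1}K2 -normrM -sqrtr_sqr ler_wsqrtr// exprMn /snorm2.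
  by rewrite (le_trans (ler_wpM2l (sqr_ge0 K) lz))// lerDl sqr_ge0.
have := snorm2_ge0 K w; have := snorm2_ge0 K v => sv sw.
rewrite -(sqr_sqrtr sw) -(sqr_sqrtr sv) -!exprMn -[leLHS]real_normK ?num_real//.
have := vle w; have := vle v; have := lle ^~ w; have := lle ^~ v.
have := sqrtr_ge0 (snorm2 K w); have := sqrtr_ge0 (snorm2 K v).
move: (Num.sqrt (snorm2 K w)) (Num.sqrt (snorm2 K v)) => W V V0 W0 lv lw hv hw.
have pt t : `|4 * p t * (rho * (along t w.1 * along t v.1) +
                     12 * (across t w.1 * across t v.1))
          - 24 * q t * (across t w.1 * v.2 + across t v.1 * w.2)| <=
    mu * (4 * rho + 96) * (W * V).
  have lwl := lw _ (along2_le t w.1); have lvl := lv _ (along2_le t v.1).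
  have lwc := lw _ (across2_le t w.1); have lvc := lv _ (across2_le t v.1).
  have mulK (a b : R) : K * `|a| <= W -> K * `|b| <= V ->
      `|p t * (a * b)| <= mu * (W * V).
    move=> aW bV; rewrite normrM.
    apply: (le_trans (ler_wpM2r (normr_ge0 _) (hp t))).
    rewrite -mulrA ler_wpM2l// normrM expr2 mulrACA ler_pM// mulr_ge0//.
  have mulh (a b X Y : R) : K * `|a| <= X -> `|b| <= Y ->
      `|q t * (a * b)| <= mu * (X * Y).
    move=> aW bV; rewrite normrM.
    apply: (le_trans (ler_wpM2r (normr_ge0 _) (hq t))).
    rewrite -mulrA ler_wpM2l// normrM mulrA ler_pM// mulr_ge0//.
  have /ler_normlP[h1 h1'] := mulK _ _ lwl lvl.
  have /ler_normlP[h2 h2'] := mulK _ _ lwc lvc.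
  have /ler_normlP[h3 h3'] := mulh _ _ _ _ lwc hv.
  have /ler_normlP[h4 h4'] := mulh _ _ _ _ lvc hw.
  have := ler_wpM2l rho0 h1; have := ler_wpM2l rho0 h1'.
  rewrite ler_norml; move=> *; apply/andP; split; lra.
have hcc : `|c * (w.2 * v.2)| <= 3 * mu * (W * V).
  by rewrite !normrM ler_pM// ?ler_pM// mulr_ge0.
rewrite lerXn2r ?nnegrE ?mulr_ge0// ?addr_ge0 ?mulr_ge0//.
rewrite (le_trans (ler_normD _ _))//.
apply: (le_trans (lerD (ler_norm_sum _ _ _) hcc)).
apply: (le_trans (lerD (ler_sum _ (fun t _ => pt t)) (lexx _))).
rewrite sumr_const card_ord -mulr_natr; lra.
Qed.

Lemma sformBr rho p q c w v v' :
  sform rho p q c w (v - v') = sform rho p q c w v - sform rho p q c w v'.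
Proof.
rewrite /sform !sum_I3 /along /across /dot /= !mxE; ring.
Qed.

Lemma sformBp rho p q c p' q' c' w v :
  sform rho p q c w v - sform rho p' q' c' w v =
  sform rho (p \- p') (q \- q') (c - c') w v.
Proof. by rewrite /sform !sum_I3 /=; ring. Qed.

(** Cancelling one factor of an energy estimate, written for squared norms so
    that square roots are avoided. *)
Lemma le_of_sqr_le_mul (x z : R) : 0 <= z -> x ^+ 2 <= x * z -> x <= z.
Proof.
move=> z0; have [x0|x0] := lerP x 0; first by move=> _; exact: le_trans x0 z0.
by rewrite expr2 ler_pM2l.
Qed.

Lemma sdot_cauchy K w v : (K * sdot w v) ^+ 2 <=
  snorm2 K w * (dot v.1 v.1 + K ^+ 2 * v.2 ^+ 2).
Proof.
rewrite /sdot /snorm2 /dot.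
move: (w.1 0 0) (w.1 1 0) w.2 (v.1 0 0) (v.1 1 0) v.2 => a b h x y g.
have := sqr_ge0 (K * (a * y - b * x)).
have := sqr_ge0 (K ^+ 2 * a * g - h * x).
have := sqr_ge0 (K ^+ 2 * b * g - h * y).
lra.
Qed.

(** Strang's argument. Testing with the error w = vD - vC, the two systems
    give D(w, w) = D(w, vD) - D(w, vC) = (C - D)(w, vC), and coercivity of D
    and the bound on C - D give |w| <= M L |vC|. Coercivity of C and Cauchy's
    inequality, with the weights K and 1 on the two components, bound K |vC|
    by M times the dual norm of the load. *)
Lemma perturbation_bound rho K M L pD qD cD pC qC cC vD vC g : 0 <= M ->
  (forall v, snorm2 K v <= M * sform rho pD qD cD v v) ->
  (forall v, snorm2 K v <= M * sform rho pC qC cC v v) ->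
  (forall w v, sform rho (pC \- pD) (qC \- qD) (cC - cD) w v ^+ 2 <=
     L ^+ 2 * (snorm2 K w * snorm2 K v)) ->
  (forall w, sform rho pD qD cD w vD = sdot w g) ->
  (forall w, sform rho pC qC cC w vC = sdot w g) ->
  K ^+ 2 * snorm2 K (vD - vC) <=
    (M ^+ 2 * L) ^+ 2 * (dot g.1 g.1 + K ^+ 2 * g.2 ^+ 2).
Proof.
move=> M0 cD_coer cC_coer bnd solD solC.
set G := dot _ _ + _.
have G0 : 0 <= G.
  by apply: addr_ge0; [exact: dot_ge0 | apply: mulr_ge0; exact: sqr_ge0].
have vC0 := snorm2_ge0 K vC; have w0 := snorm2_ge0 K (vD - vC).
have sq_mono (x y : R) : 0 <= x -> x <= y -> x ^+ 2 <= y ^+ 2.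
  by move=> x0 xy; rewrite lerXn2r ?nnegrE// (le_trans x0).
have hC : K ^+ 2 * snorm2 K vC <= M ^+ 2 * G.
  apply: le_of_sqr_le_mul; first by rewrite mulr_ge0 ?sqr_ge0.
  have := sq_mono _ _ vC0 (cC_coer vC); rewrite solC => h.
  have := ler_wpM2l (sqr_ge0 (K * M)) (sdot_cauchy K vC g).
  have := ler_wpM2l (sqr_ge0 (K ^+ 2)) h.
  rewrite -/G; lra.
have hw : snorm2 K (vD - vC) <= (M * L) ^+ 2 * snorm2 K vC.
  apply: le_of_sqr_le_mul; first by rewrite mulr_ge0 ?sqr_ge0.
  have := sq_mono _ _ w0 (cD_coer (vD - vC)).
  rewrite sformBr solD -solC sformBp => h.
  have := ler_wpM2l (sqr_ge0 M) (bnd (vD - vC) vC); lra.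
have := ler_wpM2l (sqr_ge0 K) hw; have := ler_wpM2l (sqr_ge0 (M * L)) hC.
lra.
Qed.

End RealForm.

(** * Reduction of the complex systems to the real form *)

Section Twist.
Variable R : realType.
Implicit Types (rho c K : R) (p q : 'I_3 -> R) (z g : 'cV[R[i]]_(2 + 1)).
Implicit Types (A : 'M[R]_2) (b : 'cV[R]_2).

(** The complex symbol with stiffnesses p, couplings q and inertia c. The
    factor i is pulled out of the off-diagonal block, which leaves a real
    vector. *)
Definition sym_mx rho p q c : 'M[R[i]]_(2 + 1) :=
  sys_mx (\sum_t (4 * p t) *: bond_mx rho t)
    ('i%C *: toC (\sum_t (24 * q t) *: perp (lvec R t))) c.

(** The real part of (u, h) for theta = i h. The imaginary part is, up to a
    sign, the real part of i (u, h), which is why everything below is applied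
    to z and to i z. *)
Definition twist z : 'cV[R]_2 * R :=
  (\col_m complex.Re (usubmx z m 0), complex.Im (dsubmx z 0 0)).

Lemma sum_I2 (V : zmodType) (F : 'I_2 -> V) : \sum_m F m = F 0 + F 1.
Proof.
by rewrite !big_ord_recl big_ord0 addr0; congr (_ + F _); apply: val_inj.
Qed.

Lemma colP2 (T : Type) (u v : 'cV[T]_2) :
  u 0 0 = v 0 0 -> u 1 0 = v 1 0 -> u = v.
Proof.
move=> uv0 uv1; apply/colP => -[[|[|//]] lt_m].
  by have -> : Ordinal lt_m = 0 by apply: val_inj.
by have -> : Ordinal lt_m = 1 by apply: val_inj.
Qed.

Lemma twist_sys_mx A b c z :
  twist (sys_mx A ('i%C *: toC b) c *m z) =
  (A *m (twist z).1 - (twist z).2 *: b, c * (twist z).2 - dot b (twist z).1).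
Proof.
rewrite -(vsubmxK z) /sys_mx mul_block_col /twist.
rewrite !col_mxKu !col_mxKd; move: (usubmx z) (dsubmx z) => u th /=.
have toC_mul m : complex.Re ((toC A *m u + 'i%C *: toC b *m th) m 0) =
    A m 0 * complex.Re (u 0 0) + A m 1 * complex.Re (u 1 0)
    - complex.Im (th 0 0) * b m 0.
  rewrite !mxE sum_I2 big_ord1 !mxE.
  case: (u 0 0) (u 1 0) (th 0 0) => [x0 y0] [x1 y1] [x y] /=; ring.
congr (_, _).
  by apply: colP2; rewrite mxE toC_mul !mxE sum_I2 !mxE.
rewrite !mxE sum_I2 big_ord1 !mxE /dot !mxE.
case: (u 0 0) (u 1 0) (th 0 0) => [x0 y0] [x1 y1] [x y] /=; ring.
Qed.

(** The third row of the symbol has the imaginary block - b^T; the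
    substitution theta = i h turns it into the transpose of the first two
    rows' block, so the symbol acts on twisted vectors as the symmetric form. *)
Lemma sform_twist rho p q c z w :
  sform rho p q c w (twist z) = sdot w (twist (sym_mx rho p q c *m z)).
Proof.
rewrite twist_sys_mx; move: (twist z) => v.
rewrite /sdot /sform /along /across /dot /bond_mx /outer !sum_I3 /=.
move: (perp (lvec R 0)) (perp (lvec R 1)) (perp (lvec R 2)) => m0 m1 m2.
move: (lvec R 0) (lvec R 1) (lvec R 2) => l0 l1 l2.
rewrite !(mxE, sum_I2, big_ord1).
ring.
Qed.

Lemma enorm_sqr (u : 'cV[R[i]]_2) : enorm u ^+ 2 =
  complex.Re (u 0 0) ^+ 2 + complex.Im (u 0 0) ^+ 2 +
  (complex.Re (u 1 0) ^+ 2 + complex.Im (u 1 0) ^+ 2).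
Proof.
rewrite sqr_sqrtr; last by rewrite sumr_ge0// => m _; rewrite sqr_ge0.
rewrite sum_I2; case: (u 0 0) (u 1 0) => [a b] [c d] /=.
by rewrite !sqr_sqrtr// addr_ge0 ?sqr_ge0.
Qed.

Lemma normc_sqr (x : R[i]) :
  normc x ^+ 2 = complex.Re x ^+ 2 + complex.Im x ^+ 2.
Proof. by case: x => a b /=; rewrite sqr_sqrtr// addr_ge0 ?sqr_ge0. Qed.

Lemma twist_stack (u : 'cV[R[i]]_2) (th : R[i]) : twist (stack u th) =
  (\col_m complex.Re (u m 0), complex.Im th).
Proof. by rewrite /twist /stack col_mxKu col_mxKd !mxE eqxx mulr1n. Qed.

Lemma twist_i_stack (u : 'cV[R[i]]_2) (th : R[i]) :
  twist ('i%C *: stack u th) = (\col_m - complex.Im (u m 0), complex.Re th).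
Proof.
rewrite /stack scale_col_mx /twist col_mxKu col_mxKd.
congr (_, _); last by rewrite !mxE eqxx mulr1n; case: th => a b /=; ring.
by apply/colP => m; rewrite !mxE; case: (u m 0) => a b /=; ring.
Qed.

Lemma enorm_twist u th :
  enorm u ^+ 2 = dot (twist (stack u th)).1 (twist (stack u th)).1 +
    dot (twist ('i%C *: stack u th)).1 (twist ('i%C *: stack u th)).1.
Proof.
by rewrite enorm_sqr twist_stack twist_i_stack /dot /= !mxE; ring.
Qed.

Lemma normc_twist u th :
  normc th ^+ 2 =
    (twist (stack u th)).2 ^+ 2 + (twist ('i%C *: stack u th)).2 ^+ 2.
Proof. by rewrite normc_sqr twist_stack twist_i_stack /= addrC. Qed.

Lemma stackK z : stack (usubmx z) (dsubmx z 0 0) = z.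
Proof. by rewrite /stack -mx11_scalar vsubmxK. Qed.

Lemma stackB u u' (th th' : R[i]) :
  stack (u - u') (th - th') = stack u th - stack u' th'.
Proof.
by rewrite /stack opp_col_mx add_col_mx; congr col_mx; rewrite raddfB.
Qed.

Lemma twistB z z' : twist (z - z') = twist z - twist z'.
Proof.
rewrite -(stackK z) -(stackK z') -stackB !twist_stack.
congr (_, _); last by rewrite raddfB.
by apply/colP => m; rewrite !mxE raddfB.
Qed.

Lemma twist_eq0 z : twist z = 0 -> twist ('i%C *: z) = 0 -> z = 0.
Proof.
rewrite -(stackK z) twist_stack twist_i_stack.
move: (usubmx z) (dsubmx z 0 0) => u th [/colP re_u im_th] [/colP im_u re_th].
have -> : u = 0.
  apply/colP => m; have := re_u m; have := im_u m; rewrite !mxE.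
  by case: (u m 0) => a b /= /eqP; rewrite oppr_eq0 => /eqP -> ->.
have -> : th = 0 by case: th im_th re_th => a b /= -> ->.
by rewrite /stack raddf0 col_mx0.
Qed.

Lemma snorm2_eq0 K (v : 'cV[R]_2 * R) : 0 < K -> snorm2 K v <= 0 -> v = 0.
Proof.
case: v => u h K0; rewrite /snorm2 /dot /= => le0.
have K20 : 0 < K ^+ 2 by rewrite exprn_gt0.
have hh := sqr_ge0 h; have u0 := sqr_ge0 (u 0 0); have u1 := sqr_ge0 (u 1 0).
have K0u := mulr_ge0 (ltW K20) u0; have K1u := mulr_ge0 (ltW K20) u1.
have sq0 (x : R) : x ^+ 2 <= 0 -> x = 0.
  by move=> x20; apply/eqP; rewrite -sqrf_eq0 eq_le x20 sqr_ge0.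
have h0 : h = 0 by apply: sq0; lra.
have u00 : u 0 0 = 0.
  by apply: sq0; rewrite -(pmulr_rle0 _ K20); lra.
have u10 : u 1 0 = 0.
  by apply: sq0; rewrite -(pmulr_rle0 _ K20); lra.
by rewrite h0; congr (_, _); apply: colP2; rewrite mxE.
Qed.

(** A coercive form has no kernel, and a complex kernel vector would give two
    real ones. *)
Lemma sym_mx_unit rho K M p q c : 0 < K ->
  (forall v, snorm2 K v <= M * sform rho p q c v v) ->
  sym_mx rho p q c \in unitmx.
Proof.
move=> K0 coer.
have ker z : sym_mx rho p q c *m z = 0 -> z = 0.
  have tw0 y : sym_mx rho p q c *m y = 0 -> twist y = 0.
    move=> y0; apply: (snorm2_eq0 K0); rewrite (le_trans (coer _))//.
    rewrite sform_twist y0 -(subrr (0 : 'cV__)) twistB subrr.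
    by rewrite /sdot /dot /= !mxE !mulr0 !addr0 mulr0.
  by move=> z0; apply: twist_eq0; apply: tw0; rewrite // -scalemxAr z0 scaler0.
rewrite unitmxE unitfE -det_tr; apply/det0P => -[v v0 /(congr1 trmx)].
rewrite trmx_mul trmxK trmx0 => /ker /(congr1 trmx).
by rewrite trmxK trmx0 => vE; rewrite vE eqxx in v0.
Qed.

(** The real estimates for the real and the imaginary parts add up. *)
Lemma complex_perturbation rho K M L pD qD cD pC qC cC uD thD uC thC f tau :
  0 <= M ->
  (forall v, snorm2 K v <= M * sform rho pD qD cD v v) ->
  (forall v, snorm2 K v <= M * sform rho pC qC cC v v) ->
  (forall w v, sform rho (pC \- pD) (qC \- qD) (cC - cD) w v ^+ 2 <=
     L ^+ 2 * (snorm2 K w * snorm2 K v)) ->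
  sym_mx rho pD qD cD *m stack uD thD = stack f tau ->
  sym_mx rho pC qC cC *m stack uC thC = stack f tau ->
  K ^+ 2 * (K ^+ 2 * enorm (uD - uC) ^+ 2 + normc (thD - thC) ^+ 2) <=
    (M ^+ 2 * L) ^+ 2 * (enorm f ^+ 2 + K ^+ 2 * normc tau ^+ 2).
Proof.
move=> M0 coerD coerC bnd solD solC.
rewrite (enorm_twist (uD - uC) (thD - thC)) (normc_twist (uD - uC)) stackB.
rewrite (enorm_twist f tau) (normc_twist f tau).
have twD (x : R[i]) w : sform rho pD qD cD w (twist (x *: stack uD thD)) =
    sdot w (twist (x *: stack f tau)).
  by rewrite sform_twist -scalemxAr solD.
have twC (x : R[i]) w : sform rho pC qC cC w (twist (x *: stack uC thC)) =
    sdot w (twist (x *: stack f tau)).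
  by rewrite sform_twist -scalemxAr solC.
have main x := perturbation_bound M0 coerD coerC bnd (twD x) (twC x).
have := main 1; have := main 'i%C; rewrite -!twistB -!scalerBr !scale1r.
rewrite /snorm2; lra.
Qed.

End Twist.

(** * Coercivity and consistency of the two symbols *)

Section Symbols.
Variable R : realType.
Implicit Types (rho e K : R) (a : 'I_3 -> R).

Definition lattice_wave e a t : R := sin (a t * e) / e.

Definition lattice_inertia e a : R := \sum_t (12 - 8 * sin (a t * e) ^+ 2).

Definition lattice_mx rho e a : 'M[R[i]]_(2 + 1) :=
  sym_mx rho (fun t => lattice_wave e a t ^+ 2)
    (fun t => lattice_wave e a t * cos (a t * e)) (lattice_inertia e a).

(** The instance g = 1, s = 0 of the family, written in the unsimplified form
    in which the sum of squares produces it. *)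
Definition continuum_mx rho a : 'M[R[i]]_(2 + 1) :=
  sym_mx rho (fun t => a t ^+ 2) (fun t => a t * 1)
    (\sum_(t < 3) (12 - 8 * 0 ^+ 2)).

(** For |a_t e| <= 2 the lattice wave numbers are at least |a_t|/4 (t = 0, 2),
    which is the factor 16 in 1024 = 16 * 64. *)
Lemma lattice_coercive rho e a K v : 0 < rho -> 0 < e -> a 1 = a 0 + a 2 ->
  `|a 0 * e| <= 2 -> `|a 2 * e| <= 2 -> K ^+ 2 = a 0 ^+ 2 + a 2 ^+ 2 ->
  snorm2 K v <= coercivity_const rho * sform rho
    (fun t => lattice_wave e a t ^+ 2)
    (fun t => lattice_wave e a t * cos (a t * e)) (lattice_inertia e a) v v.
Proof.
move=> rho0 e0 a1E a0_small a2_small KE.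
have e20 : 0 < e ^+ 2 by rewrite exprn_gt0.
apply: sform_coercive => //; first by move=> t; rewrite cos2Dsin2.
  rewrite /lattice_wave expr_div_n ler_pdivrMr// KE mulrDl -!exprMn.
  by rewrite (le_trans (sqr_sin_le _))// lerDl sqr_ge0.
have cos2_le1 x : cos x ^+ 2 <= 1 :> R.
  by rewrite cos2sin2 gerBl sqr_ge0.
have lb t : `|a t * e| <= 2 -> a t ^+ 2 <= 16 * lattice_wave e a t ^+ 2.
  move=> /sqr_sin_lb; rewrite /lattice_wave expr_div_n mulrA ler_pdivlMr//.
  by rewrite exprMn; lra.
have cos_or_sin t s : 15 / 16 <= cos (a s * e) ^+ 2 \/
    lattice_wave e a t ^+ 2 <= 16 * lattice_wave e a s ^+ 2.
  have [?|sin_small] := lerP (15 / 16) (cos (a s * e) ^+ 2); first by left.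
  right; rewrite /lattice_wave !expr_div_n mulrA ler_pM2r ?invr_gt0//.
  by have := cos2Dsin2 (a t * e); have := cos2Dsin2 (a s * e);
    have := sqr_ge0 (cos (a t * e)); lra.
have := along_weighted_lb v.1 (cos2_le1 (a 0 * e)) (cos2_le1 (a 2 * e)) _
  (cos_or_sin 0 2) (cos_or_sin 2 0).
have -> : lattice_wave e a 1 = lattice_wave e a 0 * cos (a 2 * e) +
    cos (a 0 * e) * lattice_wave e a 2.
  by rewrite /lattice_wave a1E mulrDl sinD; field; rewrite gt_eqF.
move=> /(_ erefl); have := ler_wpM2r (dot_ge0 v.1) (lb 0 a0_small).
have := ler_wpM2r (dot_ge0 v.1) (lb 2 a2_small).
rewrite KE; lra.
Qed.

Lemma continuum_coercive rho a K v : 0 < rho -> a 1 = a 0 + a 2 ->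
  K ^+ 2 = a 0 ^+ 2 + a 2 ^+ 2 ->
  snorm2 K v <= coercivity_const rho * sform rho (fun t => a t ^+ 2)
    (fun t => a t * 1) (\sum_(t < 3) (12 - 8 * 0 ^+ 2)) v v.
Proof.
move=> rho0 a1E KE.
apply: (sform_coercive (ga := fun=> 1) (s := fun=> 0)) => //.
- by move=> _; rewrite expr1n expr0n addr0.
- by rewrite KE lerDl sqr_ge0.
have one_le1 : 1 ^+ 2 <= 1 :> R by rewrite expr1n.
have := @along_weighted_lb R v.1 a 1 1 one_le1 one_le1.
rewrite mulr1 mul1r a1E => /(_ erefl) h; rewrite KE.
have {}h := h (or_introl _) (or_introl _).
have S0 : 0 <= \sum_t (a t * along t v.1) ^+ 2.
  by rewrite sumr_ge0// => t _; rewrite sqr_ge0.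
suff : (a 0 ^+ 2 + a 2 ^+ 2) * dot v.1 v.1 <=
    64 * \sum_t (a t * along t v.1) ^+ 2 by lra.
by apply: h; rewrite expr1n; lra.
Qed.

Lemma lattice_wave_error e (x : R) : 0 < e ->
  `|x - sin (x * e) / e| <= e ^+ 2 * `|x| ^+ 3 / 2.
Proof.
move=> e0; have en : `|e| = e by rewrite gtr0_norm.
rewrite -(ler_pM2r e0) -[X in _ * X <= _]en -normrM mulrBl divfK ?gt_eqF//.
by apply: le_trans (id_sub_sin_cubic _) _; rewrite normrM en; lra.
Qed.

Lemma lattice_wave_le e (x : R) : 0 < e -> `|sin (x * e) / e| <= `|x|.
Proof.
move=> e0; have en : `|e| = e by rewrite gtr0_norm.
by rewrite normrM normfV en ler_pdivrMr// -{2}en -normrM norm_sin_le.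
Qed.

Lemma stiffness_error e (x K : R) : 0 < e -> `|x| <= 2 * K ->
  `|x ^+ 2 - (sin (x * e) / e) ^+ 2| <= 16 * e ^+ 2 * K ^+ 2 * K ^+ 2.
Proof.
move=> e0 xK; rewrite subr_sqr normrM.
have sum_le : `|x + sin (x * e) / e| <= 2 * `|x|.
  by apply: le_trans (ler_normD _ _) _; have := lattice_wave_le x e0; lra.
apply: le_trans (ler_pM _ _ (lattice_wave_error x e0) sum_le) _ => //.
have x2K : `|x| ^+ 2 <= 4 * K ^+ 2.
  have := ler_pM (normr_ge0 x) (normr_ge0 x) xK xK; lra.
have e20 := sqr_ge0 e.
have := ler_wpM2l e20 (ler_pM (sqr_ge0 `|x|) (sqr_ge0 `|x|) x2K x2K); lra.
Qed.

(** By the duplication formula the lattice coupling is the lattice wave number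
    of 2x, halved. *)
Lemma coupling_error e (x K : R) : 0 < e -> `|x| <= 2 * K ->
  `|x - sin (x * e) / e * cos (x * e)| <= 16 * e ^+ 2 * K ^+ 2 * K.
Proof.
move=> e0 xK.
have -> : x - sin (x * e) / e * cos (x * e) =
    (x *+ 2 - sin (x *+ 2 * e) / e) / 2.
  by rewrite mulrnAl sin_mulr2n; field; rewrite gt_eqF.
rewrite normrM (gtr0_norm (_ : 0 < 2^-1)) ?invr_gt0//.
have := lattice_wave_error (x *+ 2) e0; rewrite normrMn.
have x3K : `|x| ^+ 3 <= 8 * K ^+ 3.
  have xx := ler_pM (normr_ge0 x) (normr_ge0 x) xK xK.
  have := ler_pM (mulr_ge0 (normr_ge0 x) (normr_ge0 x)) (normr_ge0 x) xx xK.
  lra.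
have := ler_wpM2l (sqr_ge0 e) x3K; lra.
Qed.

Lemma inertia_error e a K : 0 < e -> a 1 = a 0 + a 2 ->
  K ^+ 2 = a 0 ^+ 2 + a 2 ^+ 2 ->
  `|\sum_(t < 3) (12 - 8 * 0 ^+ 2) - lattice_inertia e a| <=
    3 * (16 * e ^+ 2 * K ^+ 2).
Proof.
move=> e0 a1E KE; rewrite /lattice_inertia !sum_I3.
have sin_le t := sqr_sin_le (a t * e); have sin_ge t := sqr_ge0 (sin (a t * e)).
have := sin_le 0; have := sin_le 1; have := sin_le 2.
have := sin_ge 0; have := sin_ge 1; have := sin_ge 2.
rewrite !exprMn; move: (sin _ ^+ 2) (sin _ ^+ 2) (sin _ ^+ 2) => s2 s1 s0.
move=> s20 s10 s00 s2e s1e s0e.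
have := mulr_ge0 (sqr_ge0 e) (sqr_ge0 (a 0 - a 2)).
have := mulr_ge0 (sqr_ge0 e) (sqr_ge0 (a 0 + a 2)).
rewrite KE ler_norml => h1 h2; rewrite a1E in s1e.
by apply/andP; split; lra.
Qed.

(** The consistency error mu = 16 e^2 K^2 contributes K^4 to these squared
    norms; a factor K^2 of it is spent on estimating the continuum solution by
    the load, which leaves the K^2 in front of the last factor. *)
Lemma mode_estimate rho e a K uD thD uC thC f tau : 0 < rho -> 0 < e ->
  a 1 = a 0 + a 2 -> `|a 0 * e| <= 2 -> `|a 2 * e| <= 2 ->
  0 < K -> K ^+ 2 = a 0 ^+ 2 + a 2 ^+ 2 ->
  lattice_mx rho e a *m stack uD thD = stack f tau ->
  continuum_mx rho a *m stack uC thC = stack f tau ->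
  K ^+ 2 * enorm (uD - uC) ^+ 2 + normc (thD - thC) ^+ 2 <=
    (coercivity_const rho ^+ 2 * (16 * (12 * rho + 291)) * e ^+ 2) ^+ 2 *
    (K ^+ 2 * (enorm f ^+ 2 + K ^+ 2 * normc tau ^+ 2)).
Proof.
move=> rho0 e0 a1E a0_small a2_small K0 KE solD solC.
have K20 : 0 < K ^+ 2 by rewrite exprn_gt0.
have M0 : 0 <= coercivity_const rho.
  by rewrite addr_ge0// divr_ge0// ltW.
have a_le t : `|a t| <= 2 * K.
  have aK x : x ^+ 2 <= K ^+ 2 -> `|x| <= K.
    move=> xK; rewrite -(@ler_pXn2r _ 2)// ?nnegrE ?(ltW K0)//.
    by rewrite real_normK ?num_real.
  have a0K : `|a 0| <= K by apply: aK; rewrite KE lerDl sqr_ge0.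
  have a2K : `|a 2| <= K by apply: aK; rewrite KE lerDr sqr_ge0.
  elim/forall_I3: t; [lra| |lra].
  by rewrite a1E; apply: le_trans (ler_normD _ _) _; lra.
have mu0 : 0 <= 16 * e ^+ 2 * K ^+ 2.
  exact: mulr_ge0 (mulr_ge0 (ler0n _ 16) (sqr_ge0 e)) (sqr_ge0 K).
have coupling_le t : `|a t * 1 - lattice_wave e a t * cos (a t * e)| <=
    16 * e ^+ 2 * K ^+ 2 * K.
  by rewrite mulr1; exact: coupling_error.
have := complex_perturbation M0
  (fun v => lattice_coercive v rho0 e0 a1E a0_small a2_small KE)
  (fun v => continuum_coercive v rho0 a1E KE)
  (fun w v => sform_bounded w v (ltW rho0) mu0 (ltW K0)
    (fun t => stiffness_error e0 (a_le t)) coupling_le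
    (inertia_error e0 a1E KE)) solD solC.
move=> h; rewrite -(ler_pM2l K20); apply: le_trans h _.
by rewrite le_eqVlt; apply/orP; left; apply/eqP; ring.
Qed.

End Symbols.

(** * Summation over the frequencies *)

Section Frequencies.
Variable R : realType.
Implicit Types (rho : R) (N s : nat) (k : int * int).

Definition wave k (t : 'I_3) : R := pi * (wnum k t)%:~R.

Lemma wave1E k : wave k 1 = wave k 0 + wave k 2.
Proof. by rewrite /wave /wnum /= intrD mulrDr. Qed.

Lemma wave_small N k t : (0 < N)%N -> - N%:Z <= 2 * wnum k t < N%:Z ->
  `|wave k t * eps R N| <= 2.
Proof.
move=> N0 /andP[lb ub]; have RN0 : 0 < N%:R :> R by rewrite ltr0n.
rewrite /wave /eps normrM normfV (gtr0_norm RN0) ler_pdivrMr// normrM.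
rewrite (gtr0_norm (pi_gt0 R)).
have : `|(wnum k t)%:~R| * 2 <= N%:R :> R.
  have : `|2 * wnum k t| <= N%:Z by rewrite ler_norml lb ltW.
  by rewrite -(ler_int R) intr_norm intrM normrM normr_nat mulrC.
have := pihalf_lt2 R; have := pi_gt0 R; have := normr_ge0 ((wnum k t)%:~R : R).
move: (pi : R) `|_| => x y y0 x0 x4 yN.
have : x / 2 * (y * 2) <= 2 * N%:R by apply: ler_pM; lra.
lra.
Qed.

Lemma SD_lattice rho N k : SD rho N k = lattice_mx rho (eps R N) (wave k).
Proof.
rewrite /SD /lattice_mx /sym_mx /AD /bD; congr sys_mx.
  by apply: eq_bigr => t _; rewrite /lattice_wave expr_div_n.
rewrite /toC raddf_sum scaler_sumr; apply: eq_bigr => t _.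
rewrite /= map_mxZ scalerA /=; congr (_ *: _).
rewrite -[2 * pi * _ * _]/(2 * pi * (wnum k t)%:~R * eps R N).
have -> : 2 * pi * (wnum k t)%:~R * eps R N = wave k t * eps R N *+ 2.
  by rewrite /wave; ring.
rewrite sin_mulr2n /lattice_wave.
have -> : (12 : R[i]) = 12%:C by rewrite rmorph_nat.
by apply/eqP; rewrite eq_complex /=; apply/andP; split; apply/eqP; ring.
Qed.

Lemma SC_continuum rho k : SC rho k = continuum_mx rho (wave k).
Proof.
rewrite /continuum_mx /sym_mx /SC /bC /Defs.AC; congr sys_mx.
- by apply: eq_bigr => t _; rewrite exprMn.
- rewrite /toC raddf_sum scaler_sumr; apply: eq_bigr => t _.
  rewrite /= map_mxZ scalerA /=; congr (_ *: _).
  have -> : (24 : R[i]) = 24%:C by rewrite rmorph_nat.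
  apply/eqP; rewrite eq_complex /wave /=.
  by apply/andP; split; apply/eqP; ring.
- by rewrite sum_I3; ring.
Qed.

Lemma SC0_SD0 rho N : SC rho (0, 0) = SD rho N (0, 0).
Proof.
have wave0 t : wave (0, 0) t = 0.
  by elim/forall_I3: t; rewrite /wave /wnum /= ?addr0 mulr0.
have sym_mx_ext p p' q q' c c' : p =1 p' -> q =1 q' -> c = c' ->
    sym_mx rho p q c = sym_mx rho p' q' c' by move=> /funext-> /funext-> ->.
rewrite SC_continuum SD_lattice; apply: sym_mx_ext => [t|t|].
- by rewrite /lattice_wave wave0 mul0r sin0 mul0r.
- by rewrite /lattice_wave wave0 !mul0r sin0 !mul0r.
- by apply: eq_bigr => t _; rewrite wave0 mul0r sin0.
Qed.

(** Since sqrt (X + Y) <= sqrt X + sqrt Y, it suffices to bound the squares of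
    the coefficients; x and y play the parts of the weighted loads |f|^2 and
    |tau|^2. *)
Lemma norm_fsum_le N (a x y : int * int -> R) (C D : R) :
  0 <= C -> 0 <= D -> (forall k, 0 <= x k) -> (forall k, 0 <= y k) ->
  (forall k, freqs N k -> a k ^+ 2 <= (C * D) ^+ 2 * (x k + y k)) ->
  norm0 N a <= C * D *
    (Num.sqrt (\sum_(k \in freqs N) x k) + Num.sqrt (\sum_(k \in freqs N) y k)).
Proof.
move=> C0 D0 x0 y0 axy; rewrite /norm0.
have fin := finite_freqs N.
have CD0 : 0 <= C * D by rewrite mulr_ge0.
have X0 : 0 <= \sum_(k \in freqs N) x k by apply: fsumr_ge0.
have Y0 : 0 <= \sum_(k \in freqs N) y k by apply: fsumr_ge0.
apply: (@le_trans _ _ (Num.sqrt ((C * D) ^+ 2 *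
  (\sum_(k \in freqs N) x k + \sum_(k \in freqs N) y k)))).
  rewrite ler_wsqrtr// -fsbig_split// mulr_fsumr !fsbig_finite//=.
  rewrite big_seq [leRHS]big_seq; apply: ler_sum => k.
  by rewrite in_fset_set// inE => /axy.
rewrite sqrtrM ?sqr_ge0// sqrtr_sqr ger0_norm// ler_wpM2l//.
rewrite -[leRHS]ger0_norm ?addr_ge0 ?sqrtr_ge0// -sqrtr_sqr ler_wsqrtr//.
rewrite sqrrD !sqr_sqrtr// addrAC lerDl mulrn_wge0// mulr_ge0 ?sqrtr_ge0//.
Qed.

Definition weight s k : R := (`|k.1| ^+ (2 * s) + `|k.2| ^+ (2 * s))%:~R.

Lemma weightE s k : weight s k = (k.1%:~R ^+ 2) ^+ s + (k.2%:~R ^+ 2) ^+ s.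
Proof.
rewrite /weight intrD !rmorphXn /= !intr_norm !exprM.
by rewrite !real_normK ?num_real.
Qed.

Lemma weight_ge0 s k : 0 <= weight s k.
Proof. by rewrite weightE addr_ge0// exprn_ge0// sqr_ge0. Qed.

(** Trades the K^4 |tau|^2 of the frequencywise estimate for the separate
    fourth powers in the second order seminorm. *)
Lemma weight1_sqr_le k : weight 1 k ^+ 2 <= 2 * weight 2 k.
Proof.
rewrite !weightE !expr1.
have := sqr_ge0 (k.1%:~R ^+ 2 - k.2%:~R ^+ 2 : R); lra.
Qed.

Definition wave_norm k : R := Num.sqrt (wave k 0 ^+ 2 + wave k 2 ^+ 2).

Lemma wave_norm_sqr k : wave_norm k ^+ 2 = wave k 0 ^+ 2 + wave k 2 ^+ 2.
Proof. by rewrite sqr_sqrtr// addr_ge0 ?sqr_ge0. Qed.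

Lemma wave_norm_gt0 k : k <> (0, 0) -> 0 < wave_norm k.
Proof.
move=> k0; rewrite sqrtr_gt0 lt_neqAle addr_ge0 ?sqr_ge0// andbT eq_sym.
apply/eqP => /eqP; rewrite paddr_eq0 ?sqr_ge0// !sqrf_eq0 /wave /wnum /=.
rewrite !mulf_eq0 !(gt_eqF (pi_gt0 R)) /= !intr_eq0 => /andP[/eqP k1 /eqP k2].
by apply: k0; rewrite (surjective_pairing k) k1 k2.
Qed.

Lemma wave_norm_le k : wave_norm k ^+ 2 <= 16 * weight 1 k.
Proof.
rewrite wave_norm_sqr weightE /wave /wnum /= !exprMn !expr1.
have pi2 : pi ^+ 2 <= 16 :> R.
  have := pihalf_lt2 R; have := pi_gt0 R; move: (pi : R) => x x0 x2.
  have := @ler_pM R x 4 x 4; lra.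
have := ler_wpM2r (sqr_ge0 (k.1%:~R : R)) pi2.
have := ler_wpM2r (sqr_ge0 (k.2%:~R : R)) pi2; lra.
Qed.

Definition stability_const rho : R :=
  coercivity_const rho ^+ 2 * (16 * (12 * rho + 291)).

Lemma stability_const_gt0 rho : 0 < rho -> 0 < stability_const rho.
Proof.
move=> rho0; have r0 : 0 < coercivity_const rho.
  by rewrite addr_gt0// divr_gt0.
by rewrite mulr_gt0 ?exprn_gt0//; lra.
Qed.

Lemma SD_unit rho N k : 0 < rho -> (0 < N)%N -> freqs0 N k ->
  SD rho N k \in unitmx.
Proof.
move=> rho0 N0 [[k1 k2] k0].
have e0 : 0 < eps R N by rewrite invr_gt0 ltr0n.
rewrite SD_lattice.
apply: (sym_mx_unit (M := coercivity_const rho) (wave_norm_gt0 k0)) => v.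
exact: (lattice_coercive v rho0 e0 (wave1E k) (wave_small (t := 0) N0 k1)
  (wave_small (t := 2) N0 k2) (wave_norm_sqr k)).
Qed.

Lemma SC_unit rho k : 0 < rho -> k <> (0, 0) -> SC rho k \in unitmx.
Proof.
move=> rho0 k0; rewrite SC_continuum.
apply: (sym_mx_unit (M := coercivity_const rho) (wave_norm_gt0 k0)) => v.
exact: (continuum_coercive v rho0 (wave1E k) (wave_norm_sqr k)).
Qed.

(** In the constant, 32^2 = 1024 exceeds the 16^2 * 2 = 512 that comes from
    K^2 <= 16 |k|^2, used twice, and |k|^4 <= 2 (k.1^4 + k.2^4). *)
Lemma mode_error rho N k uD thD uC thC f tau : 0 < rho -> (0 < N)%N ->
  freqs0 N k -> SD rho N k *m stack uD thD = stack f tau ->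
  SC rho k *m stack uC thC = stack f tau ->
  let C := 32 * stability_const rho * eps R N ^+ 2 in
  enorm (uD - uC) ^+ 2 <=
    C ^+ 2 * (enorm f ^+ 2 + weight 1 k * normc tau ^+ 2) /\
  normc (thD - thC) ^+ 2 <=
    C ^+ 2 * (weight 1 k * enorm f ^+ 2 + weight 2 k * normc tau ^+ 2).
Proof.
move=> rho0 N0 [[k1 k2] /= k0]; rewrite SD_lattice SC_continuum => hD hC.
have e0 : 0 < eps R N by rewrite invr_gt0 ltr0n.
have := mode_estimate rho0 e0 (wave1E k) (wave_small (t := 0) N0 k1)
  (wave_small (t := 2) N0 k2) (wave_norm_gt0 k0) (wave_norm_sqr k) hD hC.
rewrite -/(stability_const rho).
have K20 : 0 < wave_norm k ^+ 2 by rewrite exprn_gt0// wave_norm_gt0.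
have K_le := wave_norm_le k; have W2 := weight1_sqr_le k.
have W1_0 := weight_ge0 1 k; have W2_0 := weight_ge0 2 k.
move: (wave_norm k ^+ 2) (weight 1 k) (weight 2 k) K20 K_le W2 W1_0 W2_0.
move=> K2 W1 W2 K20 K_le W12 W1_0 W2_0.
have := sqr_ge0 (normc (thD - thC)); have := sqr_ge0 (enorm (uD - uC)).
have := sqr_ge0 (normc tau); have := sqr_ge0 (enorm f).
move: (enorm f ^+ 2) (normc tau ^+ 2) (enorm _ ^+ 2) (normc _ ^+ 2).
move=> F T E H F0 T0 E0 H0.
set B := (_ * _) ^+ 2 => EH; have B0 : 0 <= B by rewrite sqr_ge0.
have -> : (32 * stability_const rho * eps R N ^+ 2) ^+ 2 = 1024 * B.
  by rewrite /B; ring.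
have KT := ler_wpM2r T0 K_le.
have FT : F + K2 * T <= 16 * (F + W1 * T) by lra.
have FT0 : 0 <= F + K2 * T by rewrite addr_ge0 ?mulr_ge0 ?(ltW K20).
have BG := mulr_ge0 B0 (addr_ge0 F0 (mulr_ge0 W1_0 T0)).
split.
  have : E <= B * (F + K2 * T) by rewrite -(ler_pM2l K20); lra.
  by have := ler_wpM2l B0 FT; lra.
have KE0 := mulr_ge0 (ltW K20) E0.
have W1F := mulr_ge0 W1_0 F0; have W2T := mulr_ge0 W2_0 T0.
have KFT : K2 * (F + K2 * T) <= 512 * (W1 * F + W2 * T).
  have := ler_pM (ltW K20) FT0 K_le FT.
  have := ler_wpM2r T0 W12; lra.
have := ler_wpM2l B0 KFT.
have := mulr_ge0 B0 W1F; have := mulr_ge0 B0 W2T.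
lra.
Qed.

End Frequencies.

Theorem theorem4p9 (R : realType) (rho : R) (rho_gt0 : 0 < rho) :
  exists2 C : R, 0 < C &
  forall (N : nat) (f : 'I_N * 'I_N -> 'cV[R]_2) (tau : 'I_N * 'I_N -> R),
  (0 < N)%N ->
  range (fun z : 'cV[R[i]]_(2 + 1) => SD rho N (0, 0) *m z)
    (load f tau (0, 0)) ->
  [/\ exists u th, solves N (SD rho N) (load f tau) u th,
      exists u th, solves N (SC rho) (load f tau) u th,
      forall k, freqs0 N k ->
        exists! z : 'cV[R[i]]_(2 + 1), SD rho N k *m z = load f tau k,
      forall k, freqs0 N k ->
        exists! z : 'cV[R[i]]_(2 + 1), SC rho k *m z = load f tau k
    & forall (uD uC : int * int -> 'cV[R[i]]_2) (thD thC : int * int -> R[i]),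
      solves N (SD rho N) (load f tau) uD thD ->
      solves N (SC rho) (load f tau) uC thC ->
      uD (0, 0) = uC (0, 0) -> thD (0, 0) = thC (0, 0) ->
      norm0 N (fun k => enorm (uD k - uC k)) <=
        C * eps R N ^+ 2 *
        (norm0 N (fun k => enorm (dft_vec f k)) +
         seminorm N 1 (fun k => normc (dft_real tau k)))
      /\
      norm0 N (fun k => normc (thD k - thC k)) <=
        C * eps R N ^+ 2 *
        (seminorm N 1 (fun k => enorm (dft_vec f k)) +
         seminorm N 2 (fun k => normc (dft_real tau k)))].
Proof.
have c_gt0 := stability_const_gt0 rho_gt0.
exists (32 * stability_const rho); first by rewrite mulr_gt0.
move=> N f tau N0 [z0 _ z0E].
have unitD k : freqs0 N k -> SD rho N k \in unitmx by exact: SD_unit.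
have unitC k : freqs0 N k -> SC rho k \in unitmx by case=> _; exact: SC_unit.
have unique_sol (S : 'M[R[i]]_(2 + 1)) g : S \in unitmx ->
    exists! z : 'cV[R[i]]_(2 + 1), S *m z = g.
  move=> Su; exists (invmx S *m g); split; first by rewrite mulKVmx.
  by move=> z <-; rewrite mulKmx.
have exists_sol (S : int * int -> 'M[R[i]]_(2 + 1)) :
    (forall k, freqs0 N k -> S k \in unitmx) ->
    S (0, 0) *m z0 = load f tau (0, 0) ->
    exists u th, solves N S (load f tau) u th.
  move=> Su S0.
  pose z k := if k == (0, 0) then z0 else invmx (S k) *m load f tau k.
  exists (fun k => usubmx (z k)), (fun k => dsubmx (z k) 0 0) => k kN.
  rewrite stackK /z; case: eqP => [->//|k0].
  by rewrite mulKVmx//; apply: Su; split.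
split.
- exact: exists_sol.
- by apply: exists_sol => //; rewrite (SC0_SD0 rho N).
- by move=> k /unitD; exact: unique_sol.
- by move=> k /unitC; exact: unique_sol.
move=> uD uC thD thC solD solC u0 th0.
pose F k := enorm (dft_vec f k) ^+ 2; pose T k := normc (dft_real tau k) ^+ 2.
have F0 k : 0 <= F k by rewrite sqr_ge0.
have T0 k : 0 <= T k by rewrite sqr_ge0.
pose C : R := 32 * stability_const rho * eps R N ^+ 2.
have mode k : freqs N k ->
    enorm (uD k - uC k) ^+ 2 <= C ^+ 2 * (F k + weight R 1 k * T k) /\
    normc (thD k - thC k) ^+ 2 <=
      C ^+ 2 * (weight R 1 k * F k + weight R 2 k * T k).
  move=> kN; have [-> | /eqP k0] := eqVneq k (0, 0).
    rewrite u0 th0 !subrr enorm_sqr normc0 !mxE /= expr0n /= !addr0.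
    by split; apply: mulr_ge0;
      rewrite ?sqr_ge0// addr_ge0// mulr_ge0// weight_ge0.
  exact: (mode_error rho_gt0 N0 (conj kN k0) (solD k kN) (solC k kN)).
have C0 : 0 <= 32 * stability_const rho by rewrite mulr_ge0// ltW.
split; apply: norm_fsum_le => //; try exact: sqr_ge0.
- by move=> k; rewrite mulr_ge0 ?T0 ?weight_ge0.
- by move=> k /mode[].
- by move=> k; rewrite mulr_ge0 ?F0 ?weight_ge0.
- by move=> k; rewrite mulr_ge0 ?T0 ?weight_ge0.
- by move=> k /mode[].
Qed.
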